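(* Let $a_1,\dots,a_n$ be positive integers and let $f=x_1^{a_1+1}+\cdots+x_n^{a_n+1}$. Then the jet index of $f$ is $$j(f)=a_1+\cdots+a_n-n.$$
   Context: $k$ is an algebraically closed field of characteristic $0$ and $R=k[[x_1,\dots,x_n]]$ with maximal ideal $\mathfrak m$. For an integer $m\ge 0$ put $P_m=k[x_i^{(j)}: 1\le i\le n,\ 1\le j\le m]$. For $g\in R$ define $D_0(g),\dots,D_m(g)\in P_m$ by $$g\Big(\sum_{j=1}^m x_1^{(j)}t^j,\dots,\sum_{j=1}^m x_n^{(j)}t^j\Big)\equiv\sum_{j=0}^m D_j(g)\,t^j \pmod{t^{m+1}}.$$ For an ideal $I\subset R$ let $\overline{I}_m\subset P_m$ be the ideal generated by all $D_j(g)$ with $g\in I$, $0\le j\le m$. (Here $P_m$ is the $m$-th jet ring $R_m$ modulo $\mathfrak m R_m$, and $\overline I_m$ is the image of the $m$-th jet ideal of $I$.) The $m$-th jet closure of $I$ is $$I^{m\text{-}jc}=\{f\in R: D_j(f)\in \overline I_m \text{ for all } 0\le j\le m\};$$ in particular $I^{0\text{-}jc}=\mathfrak m$ for proper $I$. If $R/I$ is Artinian, the jet index $j(I)$ is the minimum integer $s\ge 0$ such that $I$ is $s$-jet closed, i.e. $I^{s\text{-}jc}=I$. For a weighted homogeneous polynomial $f$ with an isolated singularity at $0$, the jet index of $f$ is $j(f):=j(J(f))$, where $J(f)=(\partial_{x_1}f,\dots,\partial_{x_n}f)\subset R$. *)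

(* Defs.v *)
From HB Require Import structures.
From mathcomp Require Import all_boot all_order all_algebra.
From mathcomp Require Import boolp classical_sets.
From mathcomp Require Import mpoly.

Set Implicit Arguments.
Unset Strict Implicit.
Unset Printing Implicit Defensive.

Import GRing.Theory.
Local Open Scope ring_scope.
Local Open Scope classical_set_scope.

(* R[[x_1, ..., x_n]]: a power series is its family of coefficients. A record
   is used, rather than a bare function type, so that the pointwise ring
   structure on functions cannot be inferred for it. *)
Record mpseries (n : nat) (R : Type) :=
  MPSeries { scoef :> 'X_{1..n} -> R }.

Section PowerSeriesRing.
Variables (n : nat) (R : comNzRingType).
Implicit Types f g h : mpseries n R.

HB.instance Definition _ := gen_eqMixin (mpseries n R).
HB.instance Definition _ := gen_choiceMixin (mpseries n R).

Lemma mpseriesP f g : (forall m, f m = g m) <-> f = g.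
Proof.
split=> [|-> //]; case: f g => [f] [g] /= fg.
by congr MPSeries; apply: funext.
Qed.

Definition series0 : mpseries n R := MPSeries (fun=> 0).
Definition series1 : mpseries n R := MPSeries (fun m => (m == 0%MM)%:R).
Definition series_opp f : mpseries n R := MPSeries (fun m => - f m).
Definition series_add f g : mpseries n R := MPSeries (fun m => f m + g m).
Definition series_mul f g : mpseries n R := MPSeries (fun m =>
  \sum_(h : 'X_{1..n < (mdeg m).+1, (mdeg m).+1} | m == (h.1 + h.2)%MM)
    f h.1 * g h.2).

Definition series_trunc (d : nat) f : {mpoly R[n]} :=
  \sum_(m : 'X_{1..n < d}) f m *: 'X_[m].

Lemma mcoeff_series_trunc d f (m : 'X_{1..n}) :
  (series_trunc d f)@_m = if (mdeg m < d)%N then f m else 0.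
Proof.
rewrite /series_trunc raddf_sum /=; case: ifP => md.
  rewrite (bigD1 (BMultinom md)) //= mcoeffZ mcoeffX eqxx mulr1.
  rewrite big1 ?addr0 // => h hm; rewrite mcoeffZ mcoeffX.
  by rewrite -val_eqE /= in hm; rewrite (negPf hm) mulr0.
rewrite big1 // => h _; rewrite mcoeffZ mcoeffX.
case: eqP => [hm|_]; last by rewrite mulr0.
by rewrite -hm bmdeg in md.
Qed.

Lemma series_mul_trunc d f g (m : 'X_{1..n}) : (mdeg m < d)%N ->
  (series_trunc d f * series_trunc d g)@_m = series_mul f g m.
Proof.
move=> md; rewrite mcoeffM; apply: eq_bigr => h /eqP mh.
have := leq_ltn_trans (leq_addr (mdeg h.2) (mdeg h.1)).
have := leq_ltn_trans (leq_addl (mdeg h.1) (mdeg h.2)).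
by rewrite -mdegD -mh !mcoeff_series_trunc => -> // ->.
Qed.

Lemma series_truncM d f g (m : 'X_{1..n}) : (mdeg m < d)%N ->
  (series_trunc d (series_mul f g))@_m
  = (series_trunc d f * series_trunc d g)@_m.
Proof. by move=> md; rewrite mcoeff_series_trunc md series_mul_trunc. Qed.

Lemma mcoeffM_eq (p p' q q' : {mpoly R[n]}) (m : 'X_{1..n}) :
    (forall h : 'X_{1..n}, (mdeg h <= mdeg m)%N -> p@_h = p'@_h) ->
    (forall h : 'X_{1..n}, (mdeg h <= mdeg m)%N -> q@_h = q'@_h) ->
  (p * q)@_m = (p' * q')@_m.
Proof.
move=> pp qq; rewrite !mcoeffM; apply: eq_bigr => h _.
by rewrite pp ?qq // -ltnS bmdeg.
Qed.

Lemma series_addA : associative series_add.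
Proof. by move=> f g h; apply/mpseriesP => m /=; rewrite addrA. Qed.
Lemma series_addC : commutative series_add.
Proof. by move=> f g; apply/mpseriesP => m /=; rewrite addrC. Qed.
Lemma series_add0 : left_id series0 series_add.
Proof. by move=> f; apply/mpseriesP => m /=; rewrite add0r. Qed.
Lemma series_addN : left_inverse series0 series_opp series_add.
Proof. by move=> f; apply/mpseriesP => m /=; rewrite addNr. Qed.

HB.instance Definition _ := GRing.isZmodule.Build (mpseries n R)
  series_addA series_addC series_add0 series_addN.

Lemma series_mulA : associative series_mul.
Proof.
move=> f g h; apply/mpseriesP => m.
rewrite -!(@series_mul_trunc (mdeg m).+1) //.
rewrite (@mcoeffM_eq _ (series_trunc (mdeg m).+1 f) _
  (series_trunc (mdeg m).+1 g * series_trunc (mdeg m).+1 h)) //; last first.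
  by move=> h' h'm; rewrite series_truncM.
rewrite mulrA; apply: mcoeffM_eq => // h' h'm.
by rewrite series_truncM.
Qed.

Lemma series_mulC : commutative series_mul.
Proof.
move=> f g; apply/mpseriesP => m.
by rewrite -!(@series_mul_trunc (mdeg m).+1) // mulrC.
Qed.

Lemma series_mul1 : left_id series1 series_mul.
Proof.
move=> f; apply/mpseriesP => m.
rewrite -(@series_mul_trunc (mdeg m).+1) //.
rewrite (@mcoeffM_eq _ 1 _ (series_trunc (mdeg m).+1 f)) //; last first.
  by move=> h hm; rewrite mcoeff_series_trunc ltnS hm mcoeff1.
by rewrite mul1r mcoeff_series_trunc ltnSn.
Qed.

Lemma series_mulD : left_distributive series_mul series_add.
Proof.
move=> f g h; apply/mpseriesP => m /=; rewrite -big_split /=.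
by apply: eq_bigr => i _; rewrite mulrDl.
Qed.

Lemma series1_neq0 : series1 != 0.
Proof.
by apply/eqP => /mpseriesP /(_ 0%MM) /= /eqP; rewrite eqxx oner_eq0.
Qed.

HB.instance Definition _ := GRing.Zmodule_isComNzRing.Build (mpseries n R)
  series_mulA series_mulC series_mul1 series_mulD series1_neq0.

Definition series_of_mpoly (p : {mpoly R[n]}) : mpseries n R :=
  MPSeries (fun m => p@_m).

End PowerSeriesRing.

Definition ideal_gen (A : comNzRingType) (S : set A) : set A :=
  [set x | exists2 s : seq (A * A),
     forall c, c \in s -> S c.2 & x = \sum_(c <- s) c.1 * c.2].

Section Jets.
Variables (n : nat) (R : comNzRingType) (m : nat).

(* P_m; the variable x_i^{(j+1)}, for i : 'I_n and j : 'I_m, is the one of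
   index [mxvec_index i j], since [mxvec_index] is a bijection from
   'I_n * 'I_m to 'I_(n * m). *)
Local Notation jet_ring := {mpoly R[n * m]}.

(* \sum_(1 <= j <= m) x_i^{(j)} t^j, where t is 'X *)
Definition jet_arc (i : 'I_n) : {poly jet_ring} :=
  \sum_(j < m) ('X_(mxvec_index i j) : jet_ring) *: 'X^(j.+1).

Definition mpoly_at_arc : {mpoly R[n]} -> {poly jet_ring} :=
  mmap (polyC \o @mpolyC (n * m) R) jet_arc.

(* D_j(g), for j <= m. Each arc being divisible by t, a monomial of degree
   > m contributes 0 modulo t^(m+1), so g may be truncated to degree <= m
   before substituting; lemma [jet_coef_trunc] states that truncating further
   away makes no difference. *)
Definition jet_coef (j : nat) (g : mpseries n R) : jet_ring :=
  (mpoly_at_arc (series_trunc m.+1 g))`_j.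

Lemma mmap1_arc_coef (a : 'X_{1..n}) (j : nat) : (j < mdeg a)%N ->
  (mmap1 jet_arc a)`_j = 0.
Proof.
have arcX i : exists q, jet_arc i = q * 'X.
  exists (\sum_(j < m) ('X_(mxvec_index i j) : jet_ring) *: 'X^j).
  rewrite mulr_suml; apply: eq_bigr => l _.
  by rewrite exprSr scalerAl.
have [q Eq] : exists q, mmap1 jet_arc a = q * 'X^(mdeg a).
  have /choice [q qE] := arcX.
  exists (\prod_(i < n) q i ^+ a i).
  rewrite mdegE -prodrXr -big_split /=; apply: eq_bigr => i _.
  by rewrite qE exprMn.
by rewrite Eq coefMXn => ->.
Qed.

Lemma jet_coef_trunc (d j : nat) (g : mpseries n R) : (j <= m)%N -> (m < d)%N ->
  (mpoly_at_arc (series_trunc d g))`_j = jet_coef j g.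
Proof.
have key e : (j < e)%N -> (mpoly_at_arc (series_trunc e g))`_j
    = \sum_(a : 'X_{1..n < j.+1})
        (g a)%:MP_[n * m] * (mmap1 jet_arc a)`_j :> jet_ring.
  move=> je; have se : (msize (series_trunc e g) <= e)%N.
    rewrite msizeE; apply/bigmax_leqP_seq => a + _.
    by rewrite mcoeff_msupp mcoeff_series_trunc; case: ltnP; rewrite ?eqxx.
  rewrite /mpoly_at_arc (mmapE e se).
  rewrite coef_sum.
  under eq_bigr => a _ do
    rewrite coefCM mcoeff_series_trunc bmdeg.
  rewrite (bigID (fun a : 'X_{1..n < e} => mdeg a < j.+1)%N) /=.
  rewrite addrC big1 ?add0r; last first.
    by move=> a; rewrite -leqNgt => ja; rewrite mmap1_arc_coef ?mulr0.
  pose w (a : 'X_{1..n < j.+1}) : 'X_{1..n < e} :=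
    BMultinom (leq_trans (bmdeg a) je).
  have j0 : (mdeg (0%MM : 'X_{1..n}) < j.+1)%N by rewrite mdeg0.
  rewrite (reindex w) /=; last first.
    exists (fun b : 'X_{1..n < e} => insubd (BMultinom j0) (val b)) => b.
      by move=> _; apply: val_inj; rewrite val_insubd /= bmdeg.
    by rewrite inE => bj; apply: val_inj; rewrite /= val_insubd bj.
  by apply: eq_bigl => a; rewrite bmdeg.
move=> jm md; rewrite (key d (leq_ltn_trans jm md)).
by rewrite -(key m.+1).
Qed.

Definition jet_ideal (I : set (mpseries n R)) : set jet_ring :=
  ideal_gen [set p | exists g j, [/\ I g, (j <= m)%N & p = jet_coef j g]].

Definition jet_closure (I : set (mpseries n R)) : set (mpseries n R) :=
  [set f | forall j, (j <= m)%N -> jet_ideal I (jet_coef j f)].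

End Jets.

Definition is_jet_index n (R : comNzRingType) (I : set (mpseries n R))
    (s : nat) : Prop :=
  jet_closure s I = I /\
  forall s', jet_closure s' I = I -> (s <= s')%N.

Definition jacobian_ideal n (R : comNzRingType) (f : {mpoly R[n]}) :
    set (mpseries n R) :=
  ideal_gen [set g | exists i : 'I_n, g = series_of_mpoly f^`M(i)].

Definition is_jet_index_of n (R : comNzRingType) (f : {mpoly R[n]})
    (s : nat) : Prop :=
  is_jet_index (jacobian_ideal f) s.

(* Main.v *)
Require Import Defs.
From HB Require Import structures.
From mathcomp Require Import all_boot all_order all_algebra.
From mathcomp Require Import boolp classical_sets.
From mathcomp Require Import mpoly.
Local Open Scope ring_scope.

Import GRing.Theory.

(** The Jacobian ideal of f is J = (x_1^{a_1}, ..., x_n^{a_n}), because the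
    integers a_i + 1 are invertible in characteristic 0.  So J consists of the
    power series having no monomial in the box 0 <= c_i < a_i
    ([ideal_gen_pure_powersP]).  The largest monomial of the box,
    x^{a-1} = prod_i x_i^{a_i - 1}, has degree s = a_1 + ... + a_n - n, and the
    two halves of the statement both come from this degree.

    J is not m-jet closed for m < s: the series x^{a-1} has order s, so all of
    D_0, ..., D_m vanish on it ([jet_closure_order]) although it is not in J.

    J is s-jet closed: the jet ring has a specialisation that sends x_i^{(1)}
    to x_i and every other x_i^{(j)} to 0, that is, it restricts to the linear
    arcs (x_1 t, ..., x_n t).  It sends D_j(g) to the homogeneous part of g of
    degree j ([mcoeff_linear_jet]).  A monomial ideal contains the homogeneous
    parts of its elements, so the specialisation maps the jet ideal of J into
    polynomials without monomials in the box.  If all the D_j(f) with j <= s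
    are in the jet ideal, f therefore has no monomial in the box of degree at
    most s ([jet_closure_coef0]), which covers the entire box. *)

(** * Ideals generated by pure powers of the variables *)

Section PurePowers.
Context {n : nat} {R : comNzRingType}.
Implicit Types (f g : mpseries n R) (c d : 'X_{1..n}).

Lemma scoef_sum (T : Type) (s : seq T) (F : T -> mpseries n R) c :
  (\sum_(x <- s) F x) c = \sum_(x <- s) F x c.
Proof. by elim/big_rec2: _ => //= x y f _ <-. Qed.

Lemma scoef_mulXn g (r : R) (i : 'I_n) (e : nat) c :
  (g * series_of_mpoly (r *: 'X_i ^+ e)) c =
  if (e <= c i)%N then g (c - U_(i) *+ e)%MM * r else 0.
Proof.
set q := r *: _; pose d := (mdeg c).+1.
have -> : (g * series_of_mpoly q) c = (series_trunc d g * q)@_c.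
  rewrite -[LHS](@series_mul_trunc n R d) //; apply: mcoeffM_eq => // h hc.
  by rewrite mcoeff_series_trunc ltnS hc.
rewrite /q mpolyXn -scalerAr mcoeffZ; case: leqP => ec; last first.
  rewrite mcoeffM big1 ?mulr0 // => h /eqP ch; rewrite mcoeffX.
  case: eqP => [hE|_]; last by rewrite mulr0.
  have /(congr1 (fun u : 'X_{1..n} => u i)) := ch; rewrite -hE.
  rewrite mnmDE mulmnE mnm1E eqxx mul1n => ci.
  by rewrite ci ltnNge leq_addl in ec.
have le : (U_(i) *+ e <= c)%MM.
  apply/mnm_lepP => l; rewrite mulmnE mnm1E.
  by case: eqP => [<-|_]; rewrite ?mul1n ?mul0n.
rewrite -{1}(submK le) addmC mcoeffMX mcoeff_series_trunc ltnS.
by rewrite -{2}(submK le) mdegD leq_addr mulrC.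
Qed.

End PurePowers.

(** A series without monomials in the box is distributed over the generators
    by sending each of its monomials to the generator chosen by [pick] among
    those that divide it. *)
Lemma ideal_gen_pure_powersP (n : nat) (R : comUnitRingType)
    (r : 'I_n -> R) (a : 'I_n -> nat) (f : mpseries n R) :
  (forall i, r i \is a GRing.unit) ->
  ideal_gen
    [set g | exists i, g = series_of_mpoly (r i *: 'X_i ^+ a i)]%classic f
  <-> (forall c : 'X_{1..n}, (forall i, c i < a i)%N -> f c = 0).
Proof.
move=> r_unit; split=> [[s sP ->] c c_box | f0].
  rewrite scoef_sum big_seq big1 // => p /sP [i ->].
  by rewrite scoef_mulXn leqNgt c_box.
pose divisor c := [pick l | a l <= fun_of_multinom c l]%N.
pose quo i : mpseries n R := MPSeries (fun c : 'X_{1..n} =>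
  let d := (c + U_(i) *+ a i)%MM in
  if divisor d == Some i then f d / r i else 0).
pose gen i := series_of_mpoly (r i *: ('X_i : {mpoly R[n]}) ^+ a i).
exists [seq (quo i, gen i) | i <- enum 'I_n].
  by move=> p /mapP[i _ ->]; exists i.
rewrite big_map big_enum /=; apply/mpseriesP => c; rewrite scoef_sum.
have quoE i : (quo i * gen i) c = if divisor c == Some i then f c else 0.
  rewrite scoef_mulXn; case: leqP => ac; last first.
    rewrite /divisor; case: pickP => // l al.
    by case: eqP al => // -[->]; rewrite leqNgt ac.
  rewrite /quo /= submK; first by case: ifP; rewrite ?mul0r ?divrK.
  apply/mnm_lepP => l; rewrite mulmnE mnm1E.
  by case: eqP => [<-|_]; rewrite ?mul1n ?mul0n.
under eq_bigr do rewrite quoE.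
rewrite /divisor; case: pickP => [l _ | c_box].
  rewrite (bigD1 l) //= eqxx big1 ?addr0 // => i.
  by rewrite eq_sym => il; case: eqP => // -[li]; rewrite li eqxx in il.
by rewrite big1 // f0 // => i; rewrite ltnNge c_box.
Qed.

(** * Jets along linear arcs *)

Section LinearJets.
Context {n : nat} {R : comNzRingType} {m : nat}.
Implicit Types (f g : mpseries n R) (c : 'X_{1..n}) (I : set (mpseries n R)).

(** The variable x_i^{(1)} has the index j = 0 : 'I_m. *)
Definition linear_jet_var (v : 'I_(n * m)) : {mpoly R[n]} :=
  mxvec (\matrix_(i < n, j < m) if j == 0 :> nat then 'X_i else 0) 0 v.

Definition linear_jet : {mpoly R[n * m]} -> {mpoly R[n]} :=
  mmap (@mpolyC n R) linear_jet_var.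

HB.instance Definition _ := GRing.RMorphism.on linear_jet.

Lemma linear_jet_arc (i : 'I_n) :
  map_poly linear_jet (jet_arc R m i) = if m is 0 then 0 else 'X_i *: 'X.
Proof.
have -> : map_poly linear_jet (jet_arc R m i) =
    \sum_(j < m) (if j == 0 :> nat then 'X_i else 0) *: 'X^(j.+1).
  rewrite /jet_arc rmorph_sum; apply: eq_bigr => j _.
  rewrite /= map_polyZ map_polyXn; congr (_ *: _).
  by rewrite /= /linear_jet mmapX mmap1U /linear_jet_var mxvecE mxE.
case: m => [|m']; first by rewrite big_ord0.
by rewrite big_ord_recl big1 ?addr0 // => j _; rewrite scale0r.
Qed.

Lemma linear_jet_mmap1 c : (mdeg c <= m)%N ->
  map_poly linear_jet (mmap1 (@jet_arc n R m) c) = 'X_[c] *: 'X^(mdeg c).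
Proof.
move=> cm; rewrite /mmap1 rmorph_prod /=.
(* When m = 0 the arcs are 0, but then the monomial is 1. *)
transitivity (\prod_(i < n) (('X_i : {mpoly R[n]}) *: 'X : {poly _}) ^+ c i).
  apply: eq_bigr => i _; rewrite rmorphXn /= linear_jet_arc.
  case: m cm => //; rewrite leqn0 mdeg_eq0 => /eqP ->.
  by rewrite mnm0E !expr0.
under eq_bigr => i _ do rewrite exprZn.
by rewrite scaler_prod prodrXr -mdegE -mpolyXE_id.
Qed.

Lemma mcoeff_linear_jet (j : nat) g c : (j <= m)%N ->
  (linear_jet (jet_coef m j g))@_c = if mdeg c == j then g c else 0.
Proof.
move=> jm.
have -> : linear_jet (jet_coef m j g) =
    series_trunc m.+1 (MPSeries (fun d => if mdeg d == j then g d else 0)).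
  rewrite /jet_coef -coef_map /mpoly_at_arc /series_trunc.
  rewrite [mmap _ _ _]raddf_sum rmorph_sum /=.
  rewrite coef_sum; apply: eq_bigr => d _.
  rewrite mmapZ rmorphM mmapX /= linear_jet_mmap1 -1?ltnS ?bmdeg //.
  rewrite map_polyC coefCM coefZ coefXn /= /linear_jet mmapC.
  rewrite eq_sym; case: eqP => _; last by rewrite mulr0 mulr0 scale0r.
  by rewrite mulr1 mul_mpolyC.
rewrite mcoeff_series_trunc /= ltnS; case: leqP => // mc.
by case: eqP => // cj; rewrite -cj leqNgt mc in jm.
Qed.

(** Since B is closed under divisors, the polynomials without monomials in B
    form an ideal.  It contains the homogeneous parts of the elements of I,
    hence the image of the whole jet ideal under [linear_jet], hence also the
    homogeneous parts of f up to degree m. *)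
Lemma jet_closure_coef0 (B : set 'X_{1..n}) I f c :
    (forall d e, B (d + e)%MM -> B e) ->
    (forall g d, I g -> B d -> g d = 0) ->
  jet_closure m I f -> B c -> (mdeg c <= m)%N -> f c = 0.
Proof.
move=> B_down I0 If Bc cm; have [s sP sE] := If _ cm.
have := mcoeff_linear_jet _ f c cm; rewrite eqxx => <-.
rewrite sE rmorph_sum raddf_sum big_seq big1 //= => p /sP [g [j [Ig jm ->]]].
rewrite rmorphM mcoeffM big1 //= => h /eqP ch.
rewrite mcoeff_linear_jet //; case: ifP => _; last by rewrite mulr0.
by rewrite (I0 g) ?mulr0 //; apply: (B_down h.1); rewrite -ch.
Qed.

Lemma sub_jet_closure I f : I f -> jet_closure m I f.
Proof.
move=> If j jm; exists [:: (1, jet_coef m j f)]; last first.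
  by rewrite big_seq1 mul1r.
by move=> p; rewrite inE => /eqP ->; exists f, j.
Qed.

Lemma jet_closure_order I f :
  (forall c, (mdeg c <= m)%N -> f c = 0) -> jet_closure m I f.
Proof.
move=> f0 j _; exists [::] => //; rewrite big_nil /jet_coef.
have -> : series_trunc m.+1 f = 0.
  by rewrite /series_trunc big1 // => c _; rewrite f0 ?scale0r // -ltnS bmdeg.
by rewrite /mpoly_at_arc raddf0 coef0.
Qed.

End LinearJets.

(** * The jet index of a Fermat-type polynomial *)

Lemma mderiv_sum_pure_powers (n : nat) (R : comNzRingType) (a : 'I_n -> nat)
    (i : 'I_n) :
  (\sum_(l < n) 'X_l ^+ (a l).+1 : {mpoly R[n]})^`M(i) =
  (a i).+1%:R *: 'X_i ^+ a i.
Proof.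
rewrite raddf_sum (bigD1 i) //= big1 ?addr0 => [|l li]; rewrite mpolyXn mderivX.
  rewrite mulmnE mnm1E eqxx mul1n mpolyXn; congr (_ *: 'X_[_]).
  by rewrite mulmSr addmK.
by rewrite mulmnE mnm1E (negPf li) mul0n scale0r.
Qed.

Theorem proposition6p6 (k : closedFieldType) (char0 : [pchar k] =i pred0)
    (n : nat) (a : 'I_n -> nat) (a_gt0 : forall i, (0 < a i)%N) :
  is_jet_index_of (\sum_(i < n) 'X_i ^+ (a i).+1 : {mpoly k[n]})
    (\sum_(i < n) a i - n)%N.
Proof.
set F := (\sum_(i < n) _ : {mpoly k[n]}).
have JP (f : mpseries n k) : jacobian_ideal F f <->
    (forall c : 'X_{1..n}, (forall i, c i < a i)%N -> f c = 0).
  rewrite -(@ideal_gen_pure_powersP n k (fun i => (a i).+1%:R) a f); last first.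
    by move=> i; rewrite unitfE (pcharf0P k).1.
  rewrite /jacobian_ideal; under eq_set => g.
    under eq_exists => i do rewrite mderiv_sum_pure_powers.
    over.
  by [].
pose top : 'X_{1..n} := [multinom (a i).-1 | i < n].
have top_deg : mdeg top = (\sum_(i < n) a i - n)%N.
  rewrite mdegE; under eq_bigr do rewrite mnmE -subn1.
  by rewrite sumnB ?sum1_card ?card_ord // => i _; apply: a_gt0.
split=> [|m Jm].
  apply/seteqP; split=> f; last exact: sub_jet_closure.
  move=> Jf; apply/JP => c c_box.
  pose box := [set d : 'X_{1..n} | forall i, (d i < a i)%N]%classic.
  apply: (@jet_closure_coef0 _ _ _ box _ _ _ _ _ Jf c_box).
  - by move=> d e /= de i; apply: leq_ltn_trans (de i); rewrite mnmDE leq_addl.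
  - by move=> g d /JP; apply.
  rewrite -top_deg !mdegE; apply: leq_sum => i _.
  by rewrite mnmE -ltnS prednK ?c_box.
rewrite -top_deg leqNgt; apply/negP => m_top.
pose X_top := series_of_mpoly ('X_[top] : {mpoly k[n]}).
have : jacobian_ideal F X_top.
  rewrite -Jm; apply: jet_closure_order => c cm.
  rewrite /= mcoeffX; case: eqP => // topc.
  by rewrite topc ltnNge cm in m_top.
move=> /JP /(_ top) /=; rewrite mcoeffX eqxx => /(_ _)/eqP.
by rewrite oner_eq0 => /(_ _)/negP; apply=> // i; rewrite mnmE prednK.
Qed.
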